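(* Let $m,n,r$ be positive integers and let $(A,B)$ be a size-$r$ nonnegative factorization, where $A\in\mathbb{R}^{m\times r}_{\ge 0}$, $B\in\mathbb{R}^{r\times n}_{\ge 0}$ and $\operatorname{rank}(AB)=r$. If $(A,B)$ is infinitesimally rigid, then it is locally rigid.
   Context: Inequalities between matrices are entrywise. An infinitesimal motion of $(A,B)$ is a pair $(\dot A,\dot B)\in\mathbb{R}^{m\times r}\times\mathbb{R}^{r\times n}$ with $A\dot B+\dot A B=0$ such that for some $\epsilon>0$ one has $A+t\dot A\ge 0$ and $B+t\dot B\ge 0$ for all $t\in[0,\epsilon)$. The motion is trivial if $\dot A=AD$ and $\dot B=-DB$ for some diagonal $D\in\mathbb{R}^{r\times r}$. The factorization $(A,B)$ is infinitesimally rigid if all of its infinitesimal motions are trivial. The factorization $(A,B)$ is locally rigid if there is a neighborhood of $(A,B)$ in $\mathbb{R}^{m\times r}\times\mathbb{R}^{r\times n}$ such that every size-$r$ nonnegative factorization $(\tilde A,\tilde B)$ of the matrix $AB$ (i.e. $\tilde A\ge0$, $\tilde B\ge 0$, $\tilde A\tilde B=AB$) in that neighborhood is obtained by scaling the columns of $A$ and rows of $B$, i.e. $(\tilde A,\tilde B)=(A\Lambda,\Lambda^{-1}B)$ for a diagonal matrix $\Lambda$ with positive diagonal entries. *)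

(* Defs.v *)
From HB Require Import structures.
From mathcomp Require Import all_boot all_order all_algebra.
From mathcomp Require Import all_classical all_reals all_analysis.

Set Implicit Arguments.
Unset Strict Implicit.
Unset Printing Implicit Defensive.

Import Order.TTheory GRing.Theory Num.Theory.
Import numFieldNormedType.Exports.
Local Open Scope classical_set_scope.
Local Open Scope ring_scope.

Section Definitions.
Variables (R : realType) (m n r : nat).
Implicit Types (A dA : 'M[R]_(m, r)) (B dB : 'M[R]_(r, n)) (M : 'M[R]_(m, n)).

Definition nonneg_mx (p q : nat) (X : 'M[R]_(p, q)) : Prop :=
  forall i j, 0 <= X i j.

Definition nonneg_factorization M A B : Prop :=
  [/\ nonneg_mx A, nonneg_mx B & A *m B = M].

Definition infinitesimal_motion A B dA dB : Prop :=
  A *m dB + dA *m B = 0 /\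
  exists2 eps : R, 0 < eps &
    forall t : R, 0 <= t < eps ->
      nonneg_mx (A + t *: dA) /\ nonneg_mx (B + t *: dB).

Definition trivial_motion A B dA dB : Prop :=
  exists d : 'rV[R]_r, dA = A *m diag_mx d /\ dB = - (diag_mx d *m B).

Definition infinitesimally_rigid A B : Prop :=
  forall dA dB, infinitesimal_motion A B dA dB -> trivial_motion A B dA dB.

(* The neighborhood is taken in the product topology on pairs of matrices. *)
Definition locally_rigid A B : Prop :=
  exists2 U : set ('M[R]_(m, r) * 'M[R]_(r, n)), nbhs (A, B) U &
    forall A' B', U (A', B') -> nonneg_factorization (A *m B) A' B' ->
      exists2 l : 'rV[R]_r, (forall k, 0 < l ord0 k) &
        A' = A *m diag_mx l /\ B' = invmx (diag_mx l) *m B.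

End Definitions.

(* Main.v *)
Require Import Defs.
From HB Require Import structures.
From mathcomp Require Import all_boot all_order all_algebra.
From mathcomp Require Import all_classical all_reals all_analysis.

Set Implicit Arguments.
Unset Strict Implicit.
Unset Printing Implicit Defensive.

Import Order.TTheory GRing.Theory Num.Theory.
Import numFieldNormedType.Exports.
Local Open Scope classical_set_scope.
Local Open Scope ring_scope.

(** Rank [r] gives [A] a left inverse [L] and [B] a right inverse [K].  If
    [A' *m B' = A *m B], then [S := L *m A'] and [T := B' *m K] are inverse to
    each other, with [A' = A *m S] and [B' = T *m B]; both tend to [1] as
    [(A', B')] tends to [(A, B)].  So factorizations of [A *m B] near [(A, B)]
    are changes of basis [S] near [1], and local rigidity says that every
    admissible [S] is diagonal.

    Divide the columns of [S] by its diagonal entries and subtract [1]: the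
    result, [G], has zero diagonal and vanishes exactly when [S] is diagonal.
    Nonnegativity of [A'] and [B'] yields sign conditions on [G]: wherever
    [A] vanishes, [A *m G] is nonnegative, and wherever [B] vanishes,
    [T *m G *m B] is nonpositive.  For [T = 1] these are exactly the conditions
    under which [(A *m G, - (G *m B))] is an infinitesimal motion
    ([infinitesimal_motion_of_gauge]), so infinitesimal rigidity makes [G]
    diagonal, hence zero ([rigid_gauge_eq0]).

    What remains is to pass from [T = 1] to [T] near [1].  Zero diagonal
    and the sign conditions survive scaling [G] by a positive factor, so [G] may
    be taken on the unit sphere.  There, every [G] fails one of them at [T = 1],
    failing is an open condition on [(T, G)], and compactness of the sphere gives one neighborhood of [1] that works for
    every [G] ([near_rigid_gauge_eq0]). *)

Lemma cvg_mx (R : realType) (T : Type) (F : set_system T) (p q : nat)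
    (f : T -> 'M[R]_(p, q)) (X : 'M[R]_(p, q)) {FF : Filter F} :
  (forall i j, f x i j @[x --> F] --> X i j) -> f x @[x --> F] --> X.
Proof.
move=> fX; apply/cvg_ballP => e e0.
have : \forall x \near F, forall i j, ball (X i j) e (f x i j).
  apply: filter_forall => i; apply: filter_forall => j.
  exact: (cvg_ball (fX i j)).
by apply: filterS => x Xx; split.
Qed.

Lemma cvg_mx_coord (R : realType) (T : Type) (F : set_system T) (p q : nat)
    (f : T -> 'M[R]_(p, q)) (X : 'M[R]_(p, q)) i j {FF : Filter F} :
  f x @[x --> F] --> X -> f x i j @[x --> F] --> X i j.
Proof.
move=> fX; apply: (cvg_comp f (fun M : 'M[R]_(p, q) => M i j) fX).
exact: coord_continuous.
Qed.

Lemma cvg_mulmx (R : realType) (T : Type) (F : set_system T) (p q s : nat)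
    (f : T -> 'M[R]_(p, q)) (g : T -> 'M[R]_(q, s))
    (X : 'M[R]_(p, q)) (Y : 'M[R]_(q, s)) {FF : Filter F} :
  f x @[x --> F] --> X -> g x @[x --> F] --> Y ->
  f x *m g x @[x --> F] --> X *m Y.
Proof.
move=> fX gY; apply: cvg_mx => i j; rewrite mxE.
under eq_fun do rewrite mxE.
apply: (cvg_big (op := +%R)) => [|k _]; first exact: add_continuous.
by apply: cvgM; exact: cvg_mx_coord.
Qed.

(** Heine-Borel for row vectors carries over along [vec_mx], which is
    continuous and, the norm being the largest absolute value of an entry,
    isometric. *)
Lemma compact_unit_sphere_mx (R : realType) (p q : nat) :
  compact [set G : 'M[R]_(p, q) | `|G| = 1].
Proof.
pose S := [set v : 'rV[R]_(p * q) | `|v| = 1].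
have cS : compact S.
  apply: bounded_closed_compact.
    by exists 1; split => // x x1 v /= ->; exact: ltW.
  apply: (@preimage_closed _ _ (fun v : 'rV[R]_(p * q) => `|v|) [set 1]) => //.
    by move=> v _; exact: norm_continuous.
have normE (v : 'rV[R]_(p * q)) : `|vec_mx v : 'M[R]_(p, q)| = `|v|.
  rewrite /Num.Def.normr /= !mx_normrE; apply/eqP; rewrite eq_le; apply/andP; split.
    apply/bigmax_leP; split=> [|[i j] _ /=]; first exact: bigmax_ge_id.
    rewrite mxE.
    exact: (le_bigmax _ (fun ij => `|v ij.1 ij.2|) (0, mxvec_index i j)).
  apply/bigmax_leP; split=> [|[i k] _ /=]; first exact: bigmax_ge_id.
  rewrite (ord1 i); case/mxvec_indexP: k => a b.
  have -> : v 0 (mxvec_index a b) = (vec_mx v : 'M[R]_(p, q)) a b by rewrite mxE.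
  exact: (le_bigmax _ (fun ij => `|(vec_mx v : 'M[R]_(p, q)) ij.1 ij.2|) (a, b)).
rewrite (_ : [set G | _] = vec_mx @` S).
  apply: continuous_compact => //; apply: continuous_subspaceT => v.
  apply: (cvg_mx (FF := nbhs_filter v)) => i j; rewrite mxE; under eq_fun do rewrite mxE.
  exact: coord_continuous.
apply/seteqP; split=> [G G1|_ [v v1 <-]]; last by rewrite /= normE.
by exists (mxvec G); rewrite ?mxvecK // /S /= -normE mxvecK.
Qed.

(** A positive entry of [X] stays positive for small [t] by continuity, so only
    the zero entries of [X] constrain the direction [Y]. *)
Lemma near_nonneg_ray (R : realType) (p q : nat) (X Y : 'M[R]_(p, q)) :
  nonneg_mx X -> (forall i j, X i j = 0 -> 0 <= Y i j) ->
  \forall t \near (0 : R), 0 <= t -> nonneg_mx (X + t *: Y).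
Proof.
move=> X0 Y0.
suff : \forall t \near (0 : R), forall i j, 0 <= t -> 0 <= (X + t *: Y) i j.
  by apply: filterS => t tP t0 i j; exact: tP.
apply: (@filter_forall _ _ _ (nbhs (0 : R))) => i.
apply: (@filter_forall _ _ _ (nbhs (0 : R))) => j.
have [Xij|Xij] := eqVneq (X i j) 0.
  by near=> t => t0; rewrite !mxE Xij add0r mulr_ge0 // Y0.
have Xp : 0 < X i j by rewrite lt_neqAle eq_sym Xij X0.
have : X i j + t * Y i j @[t --> (0 : R)] --> X i j + 0 * Y i j.
  by apply: cvgD; [exact: cvg_cst|apply: cvgM; [exact: cvg_id|exact: cvg_cst]].
rewrite mul0r addr0 => /cvgr_gt /(_ _ Xp).
by apply: filterS => t tP _; rewrite !mxE ltW.
Unshelve. all: by end_near. Qed.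

(** Moving along [A *m (1 + t *: D)] and [(1 - t *: D) *m B] keeps the product
    constant to first order: these are the tangents to the changes of basis. *)
Lemma infinitesimal_motion_of_gauge (R : realType) (m n r : nat)
    (A : 'M[R]_(m, r)) (B : 'M[R]_(r, n)) (D : 'M[R]_r) :
  nonneg_mx A -> nonneg_mx B ->
  (forall i j, A i j = 0 -> 0 <= (A *m D) i j) ->
  (forall i j, B i j = 0 -> (D *m B) i j <= 0) ->
  infinitesimal_motion A B (A *m D) (- (D *m B)).
Proof.
move=> A0 B0 AD DB; split; first by rewrite mulmxN mulmxA addNr.
have Anear := near_nonneg_ray A0 AD.
have DB' i j : B i j = 0 -> 0 <= (- (D *m B)) i j.
  by move=> /DB; rewrite [in X in _ -> X]mxE oppr_ge0.
have Bnear := near_nonneg_ray B0 DB'.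
have : \forall t \near (0 : R), 0 <= t ->
    nonneg_mx (A + t *: (A *m D)) /\ nonneg_mx (B + t *: - (D *m B)).
  by apply: filterS2 Anear Bnear => t At Bt t0; split; [exact: At|exact: Bt].
move=> /nbhs_ballP [e /= e0 eP].
exists e => // t /andP[t0 te].
by apply: eP => //; rewrite /ball /= sub0r normrN ger0_norm.
Qed.

(** The zero-diagonal condition picks a complement to the diagonal matrices,
    which are the directions of the trivial motions. *)
Lemma rigid_gauge_eq0 (R : realType) (m n r : nat)
    (A : 'M[R]_(m, r)) (B : 'M[R]_(r, n)) (D : 'M[R]_r) :
  nonneg_mx A -> nonneg_mx B -> row_full A ->
  infinitesimally_rigid A B ->
  (forall k, D k k = 0) ->
  (forall i j, A i j = 0 -> 0 <= (A *m D) i j) ->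
  (forall i j, B i j = 0 -> (D *m B) i j <= 0) ->
  D = 0.
Proof.
move=> A0 B0 fA rig D0 AD DB.
have [d [/(row_full_inj fA) Dd _]] :=
  rig _ _ (infinitesimal_motion_of_gauge A0 B0 AD DB).
apply/matrixP => i j; rewrite [RHS]mxE.
have [<-|ij] := eqVneq i j; first exact: D0.
by rewrite Dd mxE (negbTE ij) mulr0n.
Qed.

(** The version of [rigid_gauge_eq0] that is stable under perturbing the
    identity to [T].  It serves for finite deformations, where the row change of
    basis [T] enters the sign condition on the zeros of [B]. *)
Lemma near_rigid_gauge_eq0 (R : realType) (m n r : nat)
    (A : 'M[R]_(m, r)) (B : 'M[R]_(r, n)) :
  nonneg_mx A -> nonneg_mx B -> row_full A ->
  infinitesimally_rigid A B ->
  \forall T \near (1%:M : 'M[R]_r), forall G : 'M[R]_r,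
    (forall k, G k k = 0) ->
    (forall i j, A i j = 0 -> 0 <= (A *m G) i j) ->
    (forall i j, B i j = 0 -> (T *m G *m B) i j <= 0) ->
    G = 0.
Proof.
move=> A0 B0 fA rig.
(* Only strict inequalities and disequalities involve T and G, so this is an
   open condition on (T, G). *)
pose violated (T G : 'M[R]_r) := [\/ exists k, G k k != 0,
  exists i j, A i j = 0 /\ (A *m G) i j < 0 |
  exists i j, B i j = 0 /\ 0 < (T *m G *m B) i j].
have : \forall T \near (1%:M : 'M[R]_r),
    [set G : 'M[R]_r | `|G| = 1] `<=` violated T.
  have /compact_near_coveringP covering := @compact_unit_sphere_mx R r r.
  apply: (covering _ _ violated (nbhs_filter _)) => D D1.
  have : violated 1%:M D.
    apply: contrapT => nv.
    suff DE : D = 0.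
      by move: D1; rewrite /= DE normr0 => /eqP; rewrite eq_sym oner_eq0.
    apply: (rigid_gauge_eq0 A0 B0 fA rig).
    - move=> k; apply/eqP/negP => /negP kP; apply: nv.
      by constructor 1; exists k.
    - move=> i j Aij; rewrite leNgt; apply/negP => ?.
      by apply: nv; constructor 2; exists i, j.
    - move=> i j Bij; rewrite leNgt; apply/negP => ?.
      by apply: nv; constructor 3; exists i, j; rewrite mul1mx.
  pose F := filter_prod (nbhs D) (nbhs (1%:M : 'M[R]_r)).
  have FF : Filter F by exact: filter_prod_filter.
  have GD : (x.1 : 'M[R]_r) @[x --> F] --> D by exact: cvg_fst.
  have T1 : (x.2 : 'M[R]_r) @[x --> F] --> (1%:M : 'M[R]_r) by exact: cvg_snd.
  case=> [[k Dk]|[i [j [Aij ADij]]]|[i [j [Bij DBij]]]].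
  - have Gk : (x.1 : 'M[R]_r) k k @[x --> F] --> D k k by exact: cvg_mx_coord.
    have := @cvgr_neq0 _ _ _ F FF _ _ Gk Dk.
    by apply: filterS => x xP; constructor 1; exists k.
  - have AG : (A *m x.1) i j @[x --> F] --> (A *m D) i j.
      by apply: cvg_mx_coord; apply: cvg_mulmx GD; exact: cvg_cst.
    have := @cvgr_lt _ _ F FF _ _ AG _ ADij.
    by apply: filterS => x xP; constructor 2; exists i, j.
  - have TGB : (x.2 *m x.1 *m B) i j @[x --> F] --> (1%:M *m D *m B) i j.
      apply: cvg_mx_coord; apply: cvg_mulmx; last exact: cvg_cst.
      exact: cvg_mulmx.
    have := @cvgr_gt _ _ F FF _ _ TGB _ DBij.
    by apply: filterS => x xP; constructor 3; exists i, j.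
apply: filterS => T TP G G0 AG TGB.
apply: contrapT => /eqP Gn0.
have nG : 0 < `|G|^-1 by rewrite invr_gt0 normr_gt0.
have /TP : `|(`|G|^-1 *: G)| = 1.
  by rewrite normrZ gtr0_norm // mulVf // normr_eq0.
case=> [[k]|[i [j [Aij]]]|[i [j [Bij]]]].
- by rewrite mxE G0 mulr0 eqxx.
- by rewrite -scalemxAr mxE pmulr_rlt0 // ltNge AG.
- by rewrite -scalemxAr -scalemxAl mxE pmulr_rgt0 // ltNge TGB.
Qed.

Lemma full_rank_factors (F : fieldType) (m n r : nat)
    (A : 'M[F]_(m, r)) (B : 'M[F]_(r, n)) :
  \rank (A *m B) = r -> row_full A /\ row_free B.
Proof.
move=> rk; split; rewrite /row_full /row_free eqn_leq.
  by rewrite rank_leq_col -[leqLHS]rk mxrankM_maxl.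
by rewrite rank_leq_row -[leqLHS]rk mxrankM_maxr.
Qed.

Unset Implicit Arguments.

Theorem proposition4p2 (R : realType) (m n r : nat)
    (hm : (0 < m)%N) (hn : (0 < n)%N) (hr : (0 < r)%N)
    (A : 'M[R]_(m, r)) (B : 'M[R]_(r, n))
    (hAB : nonneg_factorization (A *m B) A B)
    (hrank : \rank (A *m B) = r) :
  infinitesimally_rigid A B -> locally_rigid A B.
Proof.
move=> rig; have [A0 B0 _] := hAB.
have [fA fB] := full_rank_factors hrank.
pose L := pinvmx A; pose K := pinvmx B.
have LA : L *m A = 1%:M by exact: mulVpmx.
have BK : B *m K = 1%:M by exact: mulmxVp.
have fstAB : (x.1 : 'M[R]_(m, r)) @[x --> nbhs (A, B)] --> A by exact: cvg_fst.
have sndAB : (x.2 : 'M[R]_(r, n)) @[x --> nbhs (A, B)] --> B by exact: cvg_snd.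
have Scvg : L *m x.1 @[x --> nbhs (A, B)] --> (1%:M : 'M[R]_r).
  by rewrite -LA; apply: cvg_mulmx fstAB; exact: cvg_cst.
have Tcvg : x.2 *m K @[x --> nbhs (A, B)] --> (1%:M : 'M[R]_r).
  by rewrite -BK; apply: cvg_mulmx sndAB _; exact: cvg_cst.
have Sdiag : \forall x \near (A, B), forall k, 0 < (L *m x.1) k k.
  apply: (@filter_forall _ _ _ (nbhs (A, B))) => k.
  have Sk : (L *m x.1) k k @[x --> nbhs (A, B)] --> (1%:M : 'M[R]_r) k k.
    exact: cvg_mx_coord.
  by apply: (@cvgr_gt _ _ (nbhs (A, B)) _ _ _ Sk); rewrite mxE eqxx ltr01.
have Tnear := Tcvg _ (near_rigid_gauge_eq0 A0 B0 fA rig).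
have U := filterI Sdiag Tnear.
eexists; first exact: U.
move=> A' B' [/= Spos rigT] [A'0 B'0 AB'].
set S := L *m A' in Spos; set T := B' *m K in rigT.
have TS : T *m S = 1%:M.
  by apply: mulmx1C; rewrite -mulmxA (mulmxA A') AB' -(mulmxA A) BK mulmx1.
have A'E : A' = A *m S.
  have AE : A = A' *m T by rewrite /T mulmxA AB' -mulmxA BK mulmx1.
  by rewrite AE -mulmxA TS mulmx1.
have B'E : B' = T *m B.
  have BE : B = S *m B' by rewrite /S -mulmxA AB' mulmxA LA mul1mx.
  by rewrite BE mulmxA TS mul1mx.
(* S and T now matter only through these equations; as opaque names they are
   not expanded into entries of products by mxE. *)
clearbody S T.
pose l : 'rV[R]_r := \row_k S k k; pose v : 'rV[R]_r := \row_k (S k k)^-1.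
have lv : diag_mx l *m diag_mx v = 1%:M.
  apply/matrixP => i j; rewrite mul_diag_mx !mxE.
  case: eqP => [->|_]; last by rewrite mulr0.
  by rewrite !mulr1n mulfV // gt_eqF.
pose G := S *m diag_mx v - 1%:M.
have : G = 0.
  apply: rigT.
  - move=> k; rewrite /G mul_mx_diag !mxE eqxx mulfV ?subrr //.
    by rewrite gt_eqF //; exact: Spos.
  - move=> i j Aij.
    (* A G = A' diag(v) - A with A i j = 0. *)
    rewrite /G mulmxBr mulmx1 mulmxA -A'E mul_mx_diag !mxE Aij subr0.
    by rewrite mulr_ge0 // invr_ge0 ltW.
  - move=> i j Bij.
    (* T G B = diag(v) B - B' with B i j = 0, because T S = 1 and T B = B'. *)
    rewrite /G mulmxBr mulmx1 mulmxA TS mul1mx mulmxBl -B'E mul_diag_mx !mxE.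
    by rewrite Bij mulr0 sub0r oppr_le0.
move=> /eqP; rewrite subr_eq0 => /eqP Sv.
have Sl : S = diag_mx l.
  by rewrite -[LHS]mulmx1 -(mulmx1C lv) mulmxA Sv mul1mx.
exists l; first by move=> k; rewrite mxE.
split; first by rewrite -Sl.
have Su : S \in unitmx by have [_] := mulmx1_unit TS.
rewrite -Sl {1}B'E; congr (_ *m _).
by rewrite -[RHS]mul1mx -TS mulmxK.
Qed.
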